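(* Let $G$ be a graph, and let $\ell\ge1$ and $i\ge0$ be integers. If $\mathrm{gir}(G)\ge 2i+5$, then $$\mathrm{MH}_{\ell-j,\ell}(G)\cong\begin{cases}\mathbb{Z}^{2\,\#E(G)}, & j=0,\\ 0, & 1\le j\le i,\end{cases}$$ where $\#E(G)$ denotes the number of edges of $G$.
   Context: A graph means a finite simple undirected graph without loops, with nonempty vertex set $V(G)$ and edge set $E(G)$ (not necessarily connected). An $i$-cycle ($i\ge 3$) in $G$ is a tuple $(x_0,\dots,x_i)$ of vertices with $\{x_k,x_{k+1}\}\in E(G)$ for $0\le k\le i-1$, $x_0=x_i$, and $x_0,\dots,x_{i-1}$ all distinct. The local girth at a vertex $x$ is $\mathrm{gir}_x(G)=\inf\{i\ge3 \mid \text{there is an } i\text{-cycle in } G \text{ containing } x\}$, with $\inf\emptyset=\infty$, and the girth is $\mathrm{gir}(G)=\min_{x\in V(G)}\mathrm{gir}_x(G)$. Let $d(x,y)$ be the length of a shortest path between $x$ and $y$ ($\infty$ if there is none), and $L(x_0,\dots,x_k)=\sum_{i=1}^k d(x_{i-1},x_i)$. For integers $k,\ell\ge 0$, $\mathrm{MC}_{k,\ell}(G)$ is the free $\mathbb{Z}$-module generated by the tuples $(x_0,\dots,x_k)\in V(G)^{k+1}$ with $x_{i-1}\ne x_i$ for all $1\le i\le k$ and $L(x_0,\dots,x_k)=\ell$; $\mathrm{MC}_{k,\ell}(G)=0$ for $k<0$. The boundary map $\partial_{k,\ell}:\mathrm{MC}_{k,\ell}(G)\to\mathrm{MC}_{k-1,\ell}(G)$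 is given for $k\ge1$ by $\partial_{k,\ell}(x_0,\dots,x_k)=\sum_{i} (-1)^i (x_0,\dots,\hat{x}_i,\dots,x_k)$, the sum over those $1\le i\le k-1$ with $d(x_{i-1},x_{i+1})=d(x_{i-1},x_i)+d(x_i,x_{i+1})$ (the hat means deletion), and $\partial_{0,\ell}=0$. The magnitude homology is $\mathrm{MH}_{k,\ell}(G)=\ker\partial_{k,\ell}/\mathrm{Im}\,\partial_{k+1,\ell}$ (so it is $0$ for $k<0$). *)

(* Defs.v *)
From HB Require Import structures.
From mathcomp Require Import all_boot all_order all_algebra.
From mathcomp Require Import boolp.

Set Implicit Arguments.
Unset Strict Implicit.
Unset Printing Implicit Defensive.

Import GRing.Theory.
Local Open Scope ring_scope.

(* The values in {0, 1, 2, ...} U {oo} taken by distances and girths; None is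
   the point at infinity. *)
Definition enat := option nat.

Definition eadd (a b : enat) : enat :=
  if (a, b) is (Some m, Some n) then Some (m + n)%N else None.

Definition ele (a b : enat) : bool :=
  match a, b with
  | _, None => true
  | None, Some _ => false
  | Some m, Some n => (m <= n)%N
  end.

Definition emin (a b : enat) : enat := if ele a b then a else b.

(* inf {n | P n}, with inf of the empty set equal to oo. *)
Definition einf (P : pred nat) : enat :=
  if pselect (exists n, P n) is left exP then Some (ex_minn exP) else None.

Record graph := Graph {
  vertex :> finType;
  adj : rel vertex;
  adj_sym : symmetric adj;
  adj_irr : irreflexive adj;
  vertex_gt0 : (0 < #|vertex|)%N
}.

Section GraphNotions.
Variable G : graph.
Implicit Types (x y : G) (s : seq G).

Definition edges : {set {set G}} :=
  [set A : {set G} | [exists x, exists y, adj x y && (A == [set x; y])]].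

(* The cycle (x_0, ..., x_n) with x_n = x_0 is encoded by its first n
   vertices. *)
Definition local_girth x : enat :=
  einf [pred n | (3 <= n)%N &&
    [exists c : n.-tuple G, ucycleb (@adj G) c && (x \in c)]].

Definition girth : enat := \big[emin/None]_(x : G) local_girth x.

Definition dist x y : enat :=
  einf [pred n | [exists p : n.-tuple G, path (@adj G) x p && (last x p == y)]].

(* L(x_0, ..., x_k); the empty sequence is never used. *)
Definition len s : enat :=
  if s is x :: p then \big[eadd/Some 0%N]_(d <- pairmap dist x p) d
  else Some 0%N.

(* The generators of MC_{k,l}.  The degree k ranges over the integers, and
   there are no generators when k < 0. *)
Definition is_simplex (k : int) (l : nat) s : bool :=
  [&& 0 <= k, sorted (fun x y => x != y) s & len s == Some l].

Definition simplex (k : int) (l : nat) :=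
  {s : (`|k|%N).+1.-tuple G | is_simplex k l s}.

Definition MC (k : int) (l : nat) := {ffun simplex k l -> int}.

(* The generator given by the sequence s (0 if s is not a generator of
   MC_{k,l}). *)
Definition gen (k : int) (l : nat) s : MC k l :=
  [ffun t : simplex k l => ((val (val t) == s)%:R : int)].

Definition smooth s (i : nat) : bool :=
  if s is x0 :: _ then
    let x := nth x0 s in
    dist (x i.-1) (x i.+1) == eadd (dist (x i.-1) (x i)) (dist (x i) (x i.+1))
  else false.

Definition delete s (i : nat) : seq G := take i s ++ drop i.+1 s.

(* The boundary of a generator (x_0, ..., x_k), as an element of MC_{m,l}; the
   index i runs over 1 <= i <= k - 1. *)
Definition bd_gen (m : int) (l : nat) s : MC m l :=
  \sum_(1 <= i < (size s).-1 | smooth s i) gen m l (delete s i) *~ (-1) ^+ i.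

(* The boundary map MC_{k,l} -> MC_{m,l}, to be used with m = k - 1 only.  The
   target degree is a separate argument because k + 1 - 1 is not convertible
   to k. *)
Definition bd (k m : int) (l : nat) (c : MC k l) : MC m l :=
  \sum_(t : simplex k l) bd_gen m l (val (val t)) *~ c t.

Lemma bd_is_zmod_morphism k m l : zmod_morphism (@bd k m l).
Proof.
move=> c c'; rewrite /bd -sumrB; apply: eq_bigr => t _.
by rewrite !ffunE mulrzBr.
Qed.

HB.instance Definition _ k m l :=
  GRing.isZmodMorphism.Build (MC k l) (MC m l) (@bd k m l)
    (@bd_is_zmod_morphism k m l).

End GraphNotions.

Section Homology.
Variables (U V W : zmodType) (f : {additive U -> V}) (g : {additive V -> W}).

Definition in_ker : {pred V} := [pred v | g v == 0].

Lemma in_ker_closed : zmod_closed in_ker.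
Proof.
split=> [|x y]; rewrite !inE ?raddf0 // => /eqP gx /eqP gy.
by rewrite raddfB gx gy subrr.
Qed.

HB.instance Definition _ := GRing.isZmodClosed.Build V in_ker in_ker_closed.

Definition ker := {v : V | v \in in_ker}.

HB.instance Definition _ := SubChoice.on ker.
HB.instance Definition _ := [SubChoice_isSubZmodule of ker by <:].

Definition in_im : {pred ker} := [pred z | `[< exists u, f u = val z >]].

Lemma in_im_closed : zmod_closed in_im.
Proof.
split=> [|x y]; rewrite !inE; first by apply/asboolP; exists 0; rewrite !raddf0.
move=> /asboolP[u fu] /asboolP[v fv]; apply/asboolP; exists (u - v).
by rewrite !raddfB fu fv.
Qed.

HB.instance Definition _ := GRing.isZmodClosed.Build ker in_im in_im_closed.

(* Ker g / Im f, the composite of f and g being zero in all uses. *)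
Definition homology : zmodType := Quotient.quot in_im.

End Homology.

Definition MH (G : graph) (k : int) (l : nat) : zmodType :=
  homology (@bd G (k + 1) k l) (@bd G k (k - 1) l).

Definition zmod_iso (A B : zmodType) : Prop :=
  exists f : {additive A -> B}, bijective f.

(* Main.v *)
(* If the girth is at least 2i+5, any two vertices at distance at most i+2 are
   joined by a unique geodesic. Hence, for j <= i+1, a generator of MC_{l-j,l}
   amounts to a walk of length l together with a set of j deleted vertices, none
   of which is a backtracking point of the walk, and the boundary map deletes
   one more vertex. So, in these degrees, the complex splits as a sum over the
   walks of augmented cochain complexes of full simplices on the
   non-backtracking positions. Such a complex is contractible (insert the first
   non-backtracking vertex if it is deleted) unless the set of positions is
   empty, i.e., unless the walk alternates x, w, x, w, ...; there are 2 #E(G)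
   alternating walks, and they contribute only to degree l. *)
Require Import Defs.
From HB Require Import structures.
From mathcomp Require Import all_boot all_order all_algebra.
From mathcomp Require Import boolp zify.

Set Implicit Arguments.
Unset Strict Implicit.
Unset Printing Implicit Defensive.

Import GRing.Theory.
Local Open Scope ring_scope.

(** * Infima and minima of extended natural numbers *)

Lemma einf_mem (P : pred nat) n : einf P = Some n -> P n.
Proof. by rewrite /einf; case: pselect => // exP [<-]; case: ex_minnP. Qed.

Lemma einf_le (P : pred nat) n :
  P n -> exists2 m, einf P = Some m & (m <= n)%N.
Proof.
rewrite /einf => Pn; case: pselect => [exP | []]; last by exists n.
by exists (ex_minn exP) => //; case: ex_minnP => m _; apply.
Qed.

Lemma ele_big_emin (I : finType) (F : I -> enat) a x :
  ele a (\big[emin/None]_y F y) -> ele a (F x).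
Proof.
have ele_emin b c : ele a (emin b c) -> ele a b && ele a c.
  rewrite /emin; case: ifP; case: a => [a|]; case: b => [b|];
    by case: c => [c|] //=; lia.
have : x \in index_enum I by rewrite mem_index_enum.
elim: (index_enum I) => //= y r IH; rewrite big_cons in_cons.
move=> /predU1P[->|xr] /ele_emin/andP[] // _ hr; exact: IH.
Qed.

(** * Distances, geodesics and short cycles *)

Section Distance.
Variable G : graph.
Implicit Types x y z w : G.

Lemma girth_cycle g (c : seq G) : ele (Some g) (girth G) ->
  ucycleb (@adj G) c -> (2 < size c)%N -> (g <= size c)%N.
Proof.
case: c => // x c gle ucyc szc.
have [|m] := @einf_le [pred n | (3 <= n)%N &&
    [exists d : n.-tuple G, ucycleb (@adj G) d && (x \in d)]] (size (x :: c)).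
  rewrite inE szc; apply/existsP; exists (in_tuple (x :: c)).
  by rewrite ucyc mem_head.
rewrite -/(local_girth x) => Em lem; apply: leq_trans lem.
by move: gle => /(@ele_big_emin _ _ _ x); rewrite Em.
Qed.

Lemma dist_path x y n : dist x y = Some n ->
  exists p, [/\ path (@adj G) x p, last x p = y & size p = n].
Proof.
move=> /einf_mem/existsP[p /andP[xp /eqP ly]].
by exists p; split=> //; rewrite size_tuple.
Qed.

Lemma dist_le x p : path (@adj G) x p ->
  exists2 n, dist x (last x p) = Some n & (n <= size p)%N.
Proof.
move=> xp; apply: einf_le; apply/existsP; exists (in_tuple p).
by rewrite /= xp eqxx.
Qed.

Lemma distxx x : dist x x = Some 0%N.
Proof.
by have [//|n] := @dist_le x [::]; rewrite leqn0 => -> /eqP ->.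
Qed.

Lemma dist_gt0 x y n : dist x y = Some n -> x != y -> (0 < n)%N.
Proof. by move=> /dist_path[[|z p] [_ <- <-]] //=; rewrite eqxx. Qed.

Lemma dist_neq x y n : dist x y = Some n -> (0 < n)%N -> x != y.
Proof.
by move=> dxy; apply: contraTneq => xy; move: dxy; rewrite xy distxx => [[<-]].
Qed.

Lemma dist_triangle x y z m n : dist x y = Some m -> dist y z = Some n ->
  exists2 k, dist x z = Some k & (k <= m + n)%N.
Proof.
move=> /dist_path[p [xp <- <-]] /dist_path[q [yq <- <-]].
by rewrite -last_cat -size_cat; apply: dist_le; rewrite cat_path xp.
Qed.

Lemma dist_adj x y : adj x y -> dist x y = Some 1%N.
Proof.
move=> xy; have [|n /= d] := @dist_le x [:: y]; first by rewrite /= xy.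
have: x != y by apply: contraTneq xy => ->; rewrite adj_irr.
by move=> /(dist_gt0 d) n0 n1; rewrite d; congr Some; lia.
Qed.

Lemma dist_step x z n : dist x z = Some n.+1 ->
  exists2 w, adj x w & dist w z = Some n.
Proof.
move=> dxz; have [] := dist_path dxz => -[|w p] [] //= /andP[xw wp] lz [sp].
exists w => //; have [m dwz lem] := dist_le wp; rewrite lz in dwz.
have [k] := dist_triangle (dist_adj xw) dwz; rewrite dxz => [[<-]] lek.
by rewrite dwz; congr Some; lia.
Qed.

Lemma dist_adjl x w z n : adj x w -> dist w z = Some n ->
  exists2 m, dist x z = Some m & (m <= n.+1 <= m.+2)%N.
Proof.
move=> xw dwz; have [m dxz mn] := dist_triangle (dist_adj xw) dwz.
exists m => //; rewrite adj_sym in xw.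
have [k] := dist_triangle (dist_adj xw) dxz; rewrite dwz => [[<-]]; lia.
Qed.

(** Take a shortest path. Its edges record that the distance to [z] changes rather than decreases:
    this condition is symmetric, so the path can also be run backwards. *)
Lemma geodesic x z n : dist x z = Some n -> exists p,
  [/\ path [rel u v | adj u v && (dist u z != dist v z)] x p, last x p = z,
      size p = n &
      forall u, u \in p -> exists2 k, dist u z = Some k & (k < n)%N].
Proof.
elim: n x => [|n IH] x dxz.
  by have [] := dist_path dxz => -[|? ?] [] //= _ xz _; exists [::].
have [w xw dwz] := dist_step dxz; have [p [wp lz sp hp]] := IH w dwz.
exists (w :: p); split; rewrite /= ?xw ?wp ?dxz ?dwz ?sp //=.
  by rewrite andbT; apply/eqP => -[]; lia.
move=> u; rewrite in_cons => /predU1P[-> | /hp[k dk kn]]; first by exists n.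
by exists k => //; lia.
Qed.

(* Shorten the walk from [x] to [z] and back to [y] along geodesics. Recording
   that [dist ^~ z] changes along each edge rules out the shortcut by an edge
   from [x] to [y]. *)
Lemma detour x y z n : dist x z = Some n -> dist y z = Some n -> exists p,
  [/\ path [rel u v | adj u v && (dist u z != dist v z)] x p, last x p = y,
      uniq (x :: p), (size p <= n + n)%N &
      forall u, u \in p -> exists2 k, dist u z = Some k & (k <= n)%N].
Proof.
move=> dxz dyz; have [p [xp lp sp hp]] := geodesic dxz.
have [q [yq lq sq hq]] := geodesic dyz.
set e := [rel u v | adj u v && (dist u z != dist v z)] in xp yq *.
pose r := p ++ rev (belast y q).
have lr : last x r = y.
  rewrite last_cat lp; case: q lq {sq hq yq r} => [|a q] //= _.
  by rewrite rev_cons last_rcons.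
have xr : path e x r.
  rewrite cat_path xp lp -lq rev_path; apply: sub_path yq => u v.
  by rewrite /= adj_sym eq_sym.
have hr u : u \in r -> exists2 k, dist u z = Some k & (k <= n)%N.
  rewrite mem_cat mem_rev => /orP[/hp[k ? ?] | /mem_belast].
    by exists k => //; lia.
  rewrite in_cons => /predU1P[-> | /hq[k ? ?]]; first by exists n.
  by exists k => //; lia.
have srn : size r = (n + n)%N by rewrite size_cat size_rev size_belast sp sq.
move: lr; case: (shortenP xr) => p' xp' up' sub lp'.
exists p'; split=> // [|u /sub/hr //].
by rewrite -srn; apply: uniq_leq_size sub; case/andP: up'.
Qed.

Variables (i : nat) (gir : ele (Some (2 * i + 5)%N) (girth G)).

(** Otherwise a detour from [x] to [y] via [z], closed up by the edge, would be a cycle of length at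
    most [2 * n + 1], hence at most [2 * i + 3]. *)
Lemma dist_neq_adj x y z n : (n <= i.+1)%N -> adj x y ->
  dist y z = Some n -> dist x z <> Some n.
Proof.
move=> ni xy dyz dxz; have [p [xp lp up sp _]] := detour dxz dyz.
have: (2 * i + 5 <= size (x :: p))%N; last by rewrite /=; lia.
apply: girth_cycle gir _ _.
  rewrite /ucycleb up andbT /= rcons_path lp adj_sym xy andbT.
  by apply: sub_path xp => u v /andP[].
(* At least three vertices: an empty detour would make the edge a loop, and a detour of one edge
   would keep the distance to [z] unchanged. *)
case: p lp xp {up sp} => [/= xy' | w [|w' p]] //=.
  by move: xy; rewrite xy' adj_irr.
by move=> ->; rewrite dxz dyz eqxx !andbF.
Qed.

(** Two distinct first steps, joined by a detour and closed up through [x], would give a cycle of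
    length at most [2 * n + 2], hence at most [2 * i + 4]. This case uses the full girth bound. *)
Lemma first_step_unique x y y' z n : (n <= i.+1)%N ->
  dist x z = Some n.+1 -> adj x y -> adj x y' ->
  dist y z = Some n -> dist y' z = Some n -> y = y'.
Proof.
move=> ni dxz xy xy' dyz dy'z; apply/eqP/negPn/negP => ney.
have [p [yp lp up sp hp]] := detour dyz dy'z.
have: (2 * i + 5 <= size [:: x, y & p])%N; last by rewrite /=; lia.
apply: girth_cycle gir _ _; last first.
  by case: p lp {up sp hp yp} => //= yy'; rewrite yy' eqxx in ney.
rewrite /ucycleb /= xy rcons_path lp adj_sym xy' andbT.
rewrite (sub_path _ yp) => [|u v /andP[]] //=; move: up => /= ->.
rewrite andbT in_cons negb_or; apply/andP; split.
  by apply: contraTneq xy => ->; rewrite adj_irr.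
(* The vertex [x] is farther from [z] than every vertex of the detour. *)
by apply/negP => /hp[k]; rewrite dxz => -[<-]; lia.
Qed.

End Distance.

(** * Betweenness of vertices along geodesics *)

Section Between.
Variable G : graph.
Implicit Types x y z w v : G.

(** The condition under which the boundary map deletes [y]. It also holds when both sides are
    infinite, so finiteness is supplied separately. *)
Definition between x y z : bool := dist x z == eadd (dist x y) (dist y z).

Lemma betweenE x y z a b : dist x y = Some a -> dist y z = Some b ->
  between x y z = (dist x z == Some (a + b)%N).
Proof. by rewrite /between => -> ->. Qed.

Lemma between_adj x w z b : adj x w -> dist w z = Some b ->
  between x w z = (dist x z == Some b.+1).
Proof. by move=> /dist_adj dxw /(betweenE dxw). Qed.

Lemma between_adjP x w z a : adj x w -> dist x z = Some a -> between x w z ->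
  exists2 b, dist w z = Some b & a = b.+1.
Proof.
move=> xw dxz; rewrite adj_sym in xw; have [b dwz _] := dist_adjl xw dxz.
rewrite adj_sym in xw.
by rewrite (between_adj xw dwz) dxz => /eqP[->]; exists b.
Qed.

Lemma between_trans x w z v a c : adj x w -> dist x z = Some a ->
  dist z v = Some c -> between x w z -> between x z v -> between x w v.
Proof.
move=> xw dxz dzv xwz; have [b dwz ab] := between_adjP xw dxz xwz.
rewrite (betweenE dxz dzv) => /eqP dxv.
have [m dwv mle] := dist_triangle dwz dzv.
have [k] := dist_adjl xw dwv; rewrite dxv => -[<-] kle.
by rewrite (between_adj xw dwv) dxv; apply/eqP; congr Some; lia.
Qed.

Variables (i : nat) (gir : ele (Some (2 * i + 5)%N) (girth G)).

(** The distances from [x] and [w] to [v] differ by at most 1 and, being short, are not equal. So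
    exactly one of the two vertices is a step from the other towards [v]. *)
Lemma between_swap x w v a : adj x w -> dist w v = Some a -> (a <= i.+1)%N ->
  between x w v = ~~ between w x v.
Proof.
move=> xw dwv ai; have [b dxv ble] := dist_adjl xw dwv.
rewrite (between_adj xw dwv) (between_adj _ dxv) 1?adj_sym // dxv dwv.
have := dist_neq_adj gir ai xw dwv; rewrite dxv => neab.
have: b <> a by move=> eab; apply: neab; rewrite eab.
by rewrite !(inj_eq Some_inj); lia.
Qed.

(** This makes inserting [w] commute with deleting [z]. If [z] could be deleted only after the
    insertion, [x] would be a first step from [w] towards [v], hence by uniqueness the first step
    from [w] towards [z], although it is farther from [z] than [w]. *)
Lemma between_extend x w z v a c : adj x w -> w != z ->
  dist x z = Some a -> dist z v = Some c -> (a + c <= i.+2)%N ->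
  between x w z -> between w z v = between x z v.
Proof.
move=> xw wz dxz dzv aci xwz; have [b dwz ab] := between_adjP xw dxz xwz.
rewrite (betweenE dwz dzv) (betweenE dxz dzv).
have [m dwv mle] := dist_triangle dwz dzv.
have [k dxv kle] := dist_adjl xw dwv.
rewrite dwv dxv; apply/eqP/eqP => [[em]|[ek]]; congr Some; last by lia.
have b0 := dist_gt0 dwz wz; case: b => // b in dwz ab em mle b0 *.
have [u wu duz] := dist_step dwz.
have [j duv jle] := dist_triangle duz dzv.
have [j' ] := dist_adjl wu duv; rewrite dwv => -[<-] jle'.
have xwv : between x w v.
  rewrite (between_swap xw dwv); last by lia.
  have wx : adj w x by rewrite adj_sym.
  apply/negP; rewrite (between_adj wx dxv) dwv => /eqP[mk].
  have xu : x = u.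
    apply: (first_step_unique gir _ _ wx wu dxv (n := k)); first by lia.
      by rewrite dwv mk.
    by rewrite duv; congr Some; lia.
  by move: dxz; rewrite xu duz => -[]; lia.
by move: xwv; rewrite (between_adj xw dwv) dxv => /eqP[]; lia.
Qed.

(** A first step from [x] towards [z] is also one towards [v], as is [w]; uniqueness makes them
    equal. *)
Lemma between_first_step x w z v a c : adj x w -> x != z ->
  dist x z = Some a -> dist z v = Some c -> (a + c <= i.+2)%N ->
  between x z v -> between x w v -> between x w z.
Proof.
move=> xw xz dxz dzv aci; rewrite (betweenE dxz dzv) => /eqP dxv xwv.
have a0 := dist_gt0 dxz xz; case: a => // a in dxz aci dxv a0 *.
have [u xu duz] := dist_step dxz.
have [b dwv ab] := between_adjP xw dxv xwv.
have [j duv jle] := dist_triangle duz dzv.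
have [j'] := dist_adjl xu duv; rewrite dxv => -[<-] jle'.
have -> : w = u.
  apply: (first_step_unique gir _ _ xw xu dwv (n := b)); first by lia.
    by rewrite dxv ab.
  by rewrite duv; congr Some; lia.
by rewrite (between_adj xu duz) dxz.
Qed.

End Between.

(** * Generators of a given length, in all degrees at once *)

Section Chains.
Variable G : graph.
Implicit Types (x y z w v : G) (s : seq G).

Definition chain n s : bool :=
  sorted (fun x y => x != y) s && (len s == Some n).

Lemma len_cons x z s : len [:: x, z & s] = eadd (dist x z) (len (z :: s)).
Proof. by rewrite /len /= big_cons. Qed.

Lemma chain_cons n x z s : chain n [:: x, z & s] <->
  exists a b, [/\ dist x z = Some a, x != z, chain b (z :: s) & n = (a + b)%N].
Proof.
rewrite /chain len_cons /=; split=> [/andP[/andP[xz zs]] | ].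
  case: (dist x z) => [a|//]; case: (\big[_/_]_(_ <- _) _) => // b /eqP[<-].
  by exists a, b; rewrite xz zs eqxx.
by move=> [a [b [-> -> /andP[-> /eqP->] ->]]] /=.
Qed.

Lemma chain1 n x : chain n [:: x] = (n == 0%N).
Proof. by rewrite /chain /len big_nil /= eq_sym. Qed.

Lemma chain_cons2 n s : chain n s -> (0 < n)%N ->
  exists x y s', s = [:: x, y & s'].
Proof.
case: s => [|x [|y s]]; last by exists x, y, s.
  by move=> /andP[_ /eqP[<-]].
by rewrite chain1 => /eqP->.
Qed.

(** Every step has length at least 1. Consequently, if length minus degree is at most [i], two
    consecutive steps have total length at most [i.+2]. *)
Lemma chain_size n s : chain n s -> ((size s).-1 <= n)%N.
Proof.
elim: s n => [|x [|z s] IH] n // /chain_cons[a [b [dxz xz /IH /= bs ->]]].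
by have /= := dist_gt0 dxz xz; lia.
Qed.

End Chains.

(** * The dual boundary map and the contracting homotopy *)

Section Homotopy.
Variable G : graph.
Implicit Types (x y z w v : G) (s : seq G) (V : zmodType).

(* Chains are handled through their duals: [cbd phi s] is the value at the
   boundary of [s] of the additive extension of [phi], and [chom phi w s] its
   value at the image of [s] by the contracting homotopy. The latter follows [s]
   while it alternates between its head [x] and [w]. Where [s] leaves this
   alternation, it inserts the next alternating vertex if it was skipped, and
   gives 0 otherwise. *)
Fixpoint cbd V (phi : seq G -> V) s : V :=
  if s is x :: s1 then
    (if s1 is y :: z :: s2 then (- phi [:: x, z & s2]) *+ between x y z else 0)
    - cbd (fun t => phi (x :: t)) s1
  else 0.

Fixpoint chom V (phi : seq G -> V) w s : V :=
  if s is x :: s1 then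
    if s1 is z :: _ then
      if z == w then - chom (fun t => phi (x :: t)) x s1
      else (- phi [:: x, w & s1]) *+ between x w z
    else 0
  else 0.

Fixpoint alternating w s : bool :=
  if s is x :: s1 then
    if s1 is z :: _ then (z == w) && alternating x s1 else true
  else true.

Definition starts_towards w s : bool :=
  if s is [:: x, z & _] then between x w z else true.

Lemma chom_alt V (phi : seq G -> V) x w s :
  chom phi w [:: x, w & s] = - chom (fun t => phi (x :: t)) x (w :: s).
Proof. by rewrite /= eqxx. Qed.

Lemma chom_neq V (phi : seq G -> V) x w z s : z != w ->
  chom phi w [:: x, z & s] = (- phi [:: x, w, z & s]) *+ between x w z.
Proof. by move=> /negPf /= ->. Qed.

Lemma cbd1 V (phi : seq G -> V) x : cbd phi [:: x] = 0.
Proof. by rewrite /= subr0. Qed.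

Lemma cbd2 V (phi : seq G -> V) x z : cbd phi [:: x; z] = 0.
Proof. by rewrite /= !subr0. Qed.

Lemma cbd_cons V (phi : seq G -> V) x y z s : cbd phi [:: x, y, z & s] =
  (- phi [:: x, z & s]) *+ between x y z
  - cbd (fun t => phi (x :: t)) [:: y, z & s].
Proof. by []. Qed.

Lemma eq_cbd V (phi psi : seq G -> V) x s :
  (forall t, phi (x :: t) = psi (x :: t)) ->
  cbd phi (x :: s) = cbd psi (x :: s).
Proof.
move=> h /=; have -> : (fun t => phi (x :: t)) = (fun t => psi (x :: t)).
  exact/funext.
by case: s => [|y [|z s]] //; rewrite h.
Qed.

Lemma raddf_cbd (V W : zmodType) (f : {additive V -> W}) phi s :
  f (cbd phi s) = cbd (f \o phi) s.
Proof.
elim: s phi => [|x s IH] phi /=; first by rewrite raddf0.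
rewrite raddfB IH; congr (_ - _).
by case: s {IH} => [|y [|z s]]; rewrite ?raddf0 // raddfMn raddfN.
Qed.

Lemma raddf_chom (V W : zmodType) (f : {additive V -> W}) phi w s :
  f (chom phi w s) = chom (f \o phi) w s.
Proof.
elim: s phi w => [|x s IH] phi w /=; first by rewrite raddf0.
case: s IH => [|z s] IH; rewrite ?raddf0 //.
by case: eqP => _; rewrite ?raddfMn raddfN // IH.
Qed.

Lemma cbd0 V s : cbd (fun=> 0 : V) s = 0.
Proof.
elim: s => //= x s ->; rewrite subr0.
by case: s => [|y [|z s]]; rewrite ?oppr0 ?mul0rn.
Qed.

Lemma cbdN V phi s : cbd (fun t => - phi t : V) s = - cbd phi s.
Proof. by rewrite (raddf_cbd (@GRing.opp V)). Qed.

Lemma eq_chom V (phi psi : seq G -> V) w x s :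
  (forall t, phi (x :: t) = psi (x :: t)) ->
  chom phi w (x :: s) = chom psi w (x :: s).
Proof.
move=> h /=; have -> : (fun t => phi (x :: t)) = (fun t => psi (x :: t)).
  exact/funext.
by case: s => [|z s] //; rewrite h.
Qed.

(* Whether the vertex [x] is inserted or already present, [chom phi x] only
   evaluates [phi] at sequences that start by [w, x]. *)
Lemma eq_chom2 V (phi psi : seq G -> V) x w s :
  (forall t, phi [:: w, x & t] = psi [:: w, x & t]) ->
  chom phi x (w :: s) = chom psi x (w :: s).
Proof.
move=> h; case: s => [//|z s].
have [-> | /negPf zx] := eqVneq z x; last by rewrite /= zx h.
rewrite !chom_alt; congr (- _).
exact: (@eq_chom _ (phi \o cons w) (psi \o cons w)).
Qed.

End Homotopy.

(** * The homotopy identity for a given alternation *)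

Section HomotopyIdentity.
Variables (G : graph) (i : nat) (gir : ele (Some (2 * i + 5)%N) (girth G)).
Implicit Types (x y z w v : G) (s : seq G) (V : zmodType).

(** Deleting the inserted [w] gives [phi] back. The other terms cancel: [z] can be deleted before
    the insertion exactly when it can be afterwards, and [w] can still be inserted once [z] is
    gone. *)
Lemma homotopy_insert V (phi : seq G -> V) x w z s n :
  adj x w -> z != w -> chain n [:: x, z & s] -> (n <= (size s).+1 + i)%N ->
  between x w z ->
  chom (cbd phi) w [:: x, z & s] + cbd (chom phi w) [:: x, z & s]
    = phi [:: x, z & s].
Proof.
move=> xw zw /chain_cons[a [b [dxz xz zs ->]]] ni xwz.
have hz : cbd (fun t => chom phi w (x :: t)) (z :: s)
          = - cbd (fun t => phi [:: x, w & t]) (z :: s).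
  by rewrite -cbdN; apply: eq_cbd => t; rewrite chom_neq // xwz.
rewrite chom_neq // xwz mulr1n cbd_cons xwz mulr1n.
case: s zs ni hz => [|v s] zs ni hz.
  by rewrite !cbd2 addr0 subr0 opprK.
have [c [d [dzv zv vs eb]]] := (chain_cons _ _ _ _).1 zs.
have szd := chain_size vs; rewrite /= in szd ni.
rewrite cbd_cons [cbd (chom phi w) _]cbd_cons hz opprK.
move: (cbd (fun t => phi [:: x, w & t]) _) => C.
rewrite (between_extend gir xw _ dxz dzv _ xwz); last 2 first.
- by rewrite eq_sym.
- by lia.
have [xzv|_] := boolP (between x z v); last first.
  by rewrite mulr0n !sub0r add0r opprK opprD opprK -addrA addNr addr0.
(* No vertex lies strictly between the adjacent [x] and [w]. So [v], which becomes the second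
   vertex, is not [w], and the homotopy still inserts [w]. *)
have vw : v != w.
  apply/eqP => vw; move: xzv.
  rewrite (betweenE dxz dzv) vw dist_adj // => /eqP[].
  by have := dist_gt0 dxz xz; have := dist_gt0 dzv zv; lia.
rewrite !mulr1n chom_neq // (between_trans xw dxz dzv xwz xzv) mulr1n.
rewrite !opprD !opprK.
by rewrite -addrA -opprD addNr addr0.
Qed.

(** The homotopy gives 0 here, and by [between_first_step] deleting [z] cannot make [w]
    insertable. *)
Lemma homotopy_stop V (phi : seq G -> V) x w z s n :
  adj x w -> chain n [:: x, z & s] -> (n <= (size s).+1 + i)%N ->
  ~~ between x w z ->
  chom (cbd phi) w [:: x, z & s] + cbd (chom phi w) [:: x, z & s] = 0.
Proof.
move=> xw /chain_cons[a [b [dxz xz zs ->]]] ni xwz.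
have zw : z != w.
  apply: contraNneq xwz => zw.
  by rewrite zw (between_adj xw (distxx w)) dist_adj.
have hz : cbd (fun t => chom phi w (x :: t)) (z :: s) = 0.
  rewrite -[RHS](cbd0 V (z :: s)); apply: eq_cbd => t.
  by rewrite chom_neq // (negPf xwz).
rewrite chom_neq // (negPf xwz) add0r.
case: s zs ni hz => [|v s] zs ni hz; first by rewrite cbd2.
have [c [d [dzv zv vs eb]]] := (chain_cons _ _ _ _).1 zs.
have szd := chain_size vs; rewrite /= in szd ni.
rewrite cbd_cons hz subr0.
have [xzv|//] := boolP (between x z v); rewrite mulr1n.
have vw : v != w.
  apply/eqP => vw; move: xzv.
  rewrite (betweenE dxz dzv) vw dist_adj // => /eqP[].
  by have := dist_gt0 dxz xz; have := dist_gt0 dzv zv; lia.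
rewrite chom_neq //.
have [xwv|] := boolP (between x w v); last by rewrite oppr0.
case/negP: xwz; apply: (between_first_step gir xw xz dxz dzv _ xzv xwv); lia.
Qed.

(** Induction along the alternation, exchanging [x] and [w]. If [w] is second and a third vertex
    follows, either the tail starts towards [x] and the induction hypothesis gives the value, or [w]
    can be deleted and the homotopy puts it back. By [between_swap], exactly one of these
    happens. *)
Lemma homotopyP V (phi : seq G -> V) x w s n :
  adj x w -> chain n (x :: s) -> (n <= size s + i)%N ->
  chom (cbd phi) w (x :: s) + cbd (chom phi w) (x :: s)
    = phi (x :: s) *+ (starts_towards w (x :: s) && ~~ alternating w (x :: s)).
Proof.
elim: s V phi x w n => [|z s IH] V phi x w n xw xs ni.
  by rewrite cbd1 addr0.
have [xwz | xwz] := boolP (between x w z); last first.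
  by rewrite (homotopy_stop phi xw xs ni xwz) /= (negPf xwz).
have [ezw | zw] := eqVneq z w; last first.
  by rewrite (homotopy_insert phi xw zw xs ni xwz) /= xwz (negPf zw).
have wx : adj w x by rewrite adj_sym.
subst z; rewrite [starts_towards _ _]/= xwz andTb.
rewrite [alternating _ _]/= eqxx andTb -/(alternating x (w :: s)).
have [a [b [dxw xNw ws en]]] := (chain_cons _ _ _ _).1 xs.
have h1 : cbd (fun t => chom phi w (x :: t)) (w :: s)
          = - cbd (chom (fun t => phi (x :: t)) x) (w :: s).
  by rewrite -cbdN; apply: eq_cbd => t; rewrite chom_alt.
case: s IH xs ni ws h1 => [|v s] IH xs ni ws h1.
  by rewrite chom_alt cbd2 /= oppr0 addr0.
have [c [d [dwv wv vs eb]]] := (chain_cons _ _ _ _).1 ws.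
have szd := chain_size vs; rewrite /= in szd ni.
(* This edge adds 1 to both length and degree, so the bound passes to the tail. *)
have a1 : a = 1%N by move: dxw; rewrite dist_adj // => -[].
(* The homotopy on the tail yields only [[:: w, x & t]]; after a leading [x], this [w] cannot be
   deleted, since its two neighbours coincide. *)
have h2 : chom (fun t => cbd phi (x :: t)) x [:: w, v & s]
          = - chom (cbd (fun t => phi (x :: t))) x [:: w, v & s].
  rewrite (raddf_chom (@GRing.opp V)); apply: eq_chom2 => t.
  rewrite /comp cbd_cons; have /negPf -> : ~~ between x w x.
    by rewrite (between_adj xw (dist_adj wx)) distxx.
  by rewrite mulr0n add0r.
rewrite chom_alt h2 opprK [cbd (chom phi w) _]cbd_cons h1 opprK addrCA.
rewrite (IH _ _ _ _ _ wx ws); last by rewrite /=; lia.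
rewrite [starts_towards _ _]/=.
have := between_swap gir xw dwv; move=> ->; last by lia.
have [wxv|wxv] := boolP (between w x v); first by rewrite mulr0n add0r.
have xwv : between x w v by rewrite (between_swap gir xw dwv) //; lia.
have vw : v != w by rewrite eq_sym.
have /negPf vx : v != x.
  apply: contraNneq wxv => ->.
  by rewrite (between_adj wx (distxx x)) dist_adj.
by rewrite [alternating _ _]/= vx addr0 mulr1n chom_neq // xwv opprK.
Qed.

End HomotopyIdentity.

(** * Restriction to true generators, and the choice of the alternation *)

Section Locality.
Variable G : graph.
Implicit Types (x y z w v : G) (s t : seq G) (V : zmodType).

Lemma chain_between n x y z s : between x y z ->
  chain n [:: x, y, z & s] -> chain n [:: x, z & s].
Proof.
move=> xyz /chain_cons[a [b [dxy xy /chain_cons[c [d [dyz yz zs ->]]] ->]]].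
move: xyz; rewrite (betweenE dxy dyz) => /eqP dxz.
apply/chain_cons; exists (a + c)%N, d; split=> //; last by rewrite addnA.
by apply: (dist_neq dxz); have := dist_gt0 dxy xy; lia.
Qed.

Lemma chain_insert n x w z s : adj x w -> z != w -> between x w z ->
  chain n [:: x, z & s] -> chain n [:: x, w, z & s].
Proof.
move=> xw zw xwz /chain_cons[a [b [dxz xz zs ->]]].
have [a' dwz ->] := between_adjP xw dxz xwz.
apply/chain_cons; exists 1%N, (a' + b)%N; rewrite dist_adj //; split=> //.
  by apply: contraTneq xw => ->; rewrite adj_irr.
by apply/chain_cons; exists a', b; rewrite eq_sym.
Qed.

(** Needed because [extend_gen] recovers [phi] only at true generators. The faces are such, as
    deletions preserve the length. *)
Lemma cbd_local V (phi psi : seq G -> V) n x s : chain n (x :: s) ->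
  (forall t, chain n (x :: t) -> (size t).+1 = size s ->
     phi (x :: t) = psi (x :: t)) ->
  cbd phi (x :: s) = cbd psi (x :: s).
Proof.
elim: s phi psi n x => [|y [|z s] IH] phi psi n x xs h; rewrite ?cbd1 ?cbd2 //.
rewrite !cbd_cons; congr (_ - _).
  have [xyz|//] := boolP (between x y z).
  by rewrite h //; exact: chain_between xs.
have [a [b [dxy xy ys en]]] := (chain_cons _ _ _ _).1 xs.
apply: IH ys _ => t yt st; apply: h; last by rewrite /= st.
by apply/chain_cons; exists a, b.
Qed.

Lemma chom_local V (phi psi : seq G -> V) n x w s : adj x w ->
  chain n (x :: s) ->
  (forall t, chain n (x :: t) -> size t = (size s).+1 ->
     phi (x :: t) = psi (x :: t)) ->
  chom phi w (x :: s) = chom psi w (x :: s).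
Proof.
elim: s phi psi n x w => [//|z s IH] phi psi n x w xw xs h.
have [ezw|zw] := eqVneq z w; last first.
  rewrite !chom_neq //; have [xwz|//] := boolP (between x w z).
  by rewrite h //; apply: chain_insert.
have [a [b [dxz xz zs en]]] := (chain_cons _ _ _ _).1 xs; subst z.
rewrite !chom_alt; congr (- _).
apply: (IH (fun t => phi (x :: t)) (fun t => psi (x :: t)) _ _ _ _ zs).
  by rewrite adj_sym.
by move=> t wt st; apply: h; [apply/chain_cons; exists a, b | rewrite /= st].
Qed.

(** All steps are edges, so alternating generators occur only where the degree equals the length. *)
Lemma alternating_chain n x w s : adj x w -> chain n (x :: s) ->
  alternating w (x :: s) -> n = size s.
Proof.
elim: s n x w => [|z s IH] n x w xw; first by rewrite chain1 => /eqP.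
move=> /chain_cons[a [b [dxz xz zs ->]]] /= /andP[/eqP ezw alt]; subst z.
move: dxz; rewrite dist_adj // => -[<-].
by rewrite (IH _ _ _ _ zs alt) // adj_sym.
Qed.

Lemma cbd_sum V (phi : seq G -> V) s :
  \sum_(1 <= i < (size s).-1 | smooth s i) phi (delete s i) *~ (-1) ^+ i
  = cbd phi s.
Proof.
elim: s phi => [|x s IH] phi; first by rewrite big_geq.
case: s IH => [|y [|z s]] IH; first by rewrite cbd1 big_geq.
  by rewrite cbd2 big_geq.
(* Split off index 1; the other terms are those of the tail, shifted by one and so with opposite
   sign. *)
rewrite cbd_cons -IH [LHS]big_mkcond [LHS]big_ltn //.
rewrite [smooth _ _]/= expr1 mulrN1z [delete _ 1]/=.
congr (_ + _); first by rewrite /between; case: ifP.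
rewrite -sumrN [RHS]big_mkcond big_add1 /= !big_nat.
apply: eq_bigr => -[//|j] hj; have {}hj : (j < size s)%N by move: hj => /=; lia.
(* The default of [nth] is the head, which changes for the tail; all indices are in range. *)
rewrite /smooth /= !(set_nth_default y x) /=; try lia.
by rewrite [(-1) ^+ j.+2]exprS mulN1r mulrNz; case: ifP.
Qed.

(** A choice of first step; the default [x] is not reached for distinct vertices at finite
    distance. *)
Definition step x y : G := odflt x [pick w | adj x w && between x w y].

Lemma stepP x y n : dist x y = Some n -> x != y ->
  adj x (step x y) && between x (step x y) y.
Proof.
move=> dxy xy; rewrite /step; case: pickP => //= none.
case: n dxy (dist_gt0 dxy xy) => // n dxy _; have [w xw dwy] := dist_step dxy.
by have := none w; rewrite xw (between_adj xw dwy) dxy eqxx.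
Qed.

Definition contract V (phi : seq G -> V) s : V :=
  if s is [:: x, y & _] then chom phi (step x y) s else 0.

Variables (i : nat) (gir : ele (Some (2 * i + 5)%N) (girth G)).

(** A first step towards [y] is one towards [z], and these are unique. Hence deleting [y] does not
    change the alternation that the homotopy follows. *)
Lemma step_between x y z a b : dist x y = Some a -> x != y ->
  dist y z = Some b -> (a + b <= i.+2)%N -> between x y z ->
  step x z = step x y.
Proof.
move=> dxy xy dyz abi xyz; have /andP[xw xwy] := stepP dxy xy.
have xwz := between_trans xw dxy dyz xwy xyz.
move: (xyz); rewrite (betweenE dxy dyz) => /eqP dxz.
have a0 := dist_gt0 dxy xy.
have xz : x != z by apply: (dist_neq dxz); lia.
have /andP[xu xuz] := stepP dxz xz.
have [c dwz ac] := between_adjP xw dxz xwz.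
have [d duz ad] := between_adjP xu dxz xuz.
apply: (first_step_unique gir _ _ xu xw duz); first by lia.
  by rewrite dxz ad.
by rewrite dwz; congr Some; lia.
Qed.

Lemma cbd_contract V (phi : seq G -> V) n x y s : chain n [:: x, y & s] ->
  (n <= (size s).+1 + i)%N ->
  cbd (contract phi) [:: x, y & s] = cbd (chom phi (step x y)) [:: x, y & s].
Proof.
case: s => [|z s] xs ni; first by rewrite !cbd2.
(* Terms that keep the first two vertices agree by computation; only deleting [y] could change the
   step. *)
rewrite [LHS]cbd_cons [RHS]cbd_cons; congr (_ - _).
have [xyz|//] := boolP (between x y z); rewrite /contract.
have [a [b [dxy xy ys en]]] := (chain_cons _ _ _ _).1 xs.
have [c [d [dyz yz zs eb]]] := (chain_cons _ _ _ _).1 ys.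
have szd := chain_size zs; rewrite /= in szd ni.
by rewrite (step_between dxy xy dyz _ xyz) //; lia.
Qed.

Lemma homotopy V (phi : seq G -> V) n x y s : chain n [:: x, y & s] ->
  (n <= (size s).+1 + i)%N ->
  contract (cbd phi) [:: x, y & s] + cbd (contract phi) [:: x, y & s]
    = phi [:: x, y & s] *+ ~~ alternating (step x y) [:: x, y & s].
Proof.
move=> xs ni; rewrite (cbd_contract phi xs ni).
have [a [b [dxy xy ys en]]] := (chain_cons _ _ _ _).1 xs.
have /andP[xw xwy] := stepP dxy xy.
by rewrite (homotopyP gir phi xw xs ni) /= xwy.
Qed.

End Locality.

(** * Additive extension from generators to magnitude chains *)

Section Extension.
Variables (G : graph) (V : zmodType).
Implicit Types (s : seq G) (k m : int) (l : nat) (phi : seq G -> V).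

Definition extend k l phi (c : MC G k l) : V :=
  \sum_(t : simplex G k l) phi (val (val t)) *~ c t.

Lemma extend_is_zmod_morphism k l phi : zmod_morphism (@extend k l phi).
Proof.
move=> c c'; rewrite /extend -sumrB; apply: eq_bigr => t _.
by rewrite !ffunE mulrzBr.
Qed.

HB.instance Definition _ k l phi :=
  GRing.isZmodMorphism.Build (MC G k l) V (@extend k l phi)
    (@extend_is_zmod_morphism k l phi).

Lemma chain_simplex k l (t : simplex G k l) : chain l (val (val t)).
Proof. by case/and3P: (valP t) => _ *; apply/andP. Qed.

Lemma exists_simplex k l s : 0 <= k -> size s = (`|k|%N).+1 -> chain l s ->
  exists t : simplex G k l, val (val t) = s.
Proof.
move=> k0 /eqP szs /andP[s1 s2].
have ht : is_simplex k l (Tuple szs) by rewrite /is_simplex k0 s1.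
by exists (Sub (Tuple szs) ht).
Qed.

Lemma extend_gen k l phi s : 0 <= k -> size s = (`|k|%N).+1 -> chain l s ->
  extend phi (gen k l s) = phi s.
Proof.
move=> k0 szs /(exists_simplex k0 szs)[t <-].
rewrite /extend (bigD1 t) //= big1 ?addr0 => [|u ut].
  by rewrite ffunE eqxx mulr1z.
by rewrite ffunE !(inj_eq val_inj) (negPf ut) mulr0z.
Qed.

End Extension.

(** * The homotopy identity in the magnitude complex *)

Section Complex.
Variable G : graph.
Implicit Types (s : seq G) (k m : int) (l : nat) (V W : zmodType).

Lemma extend_genE k l (c : MC G k l) : extend (gen k l) c = c.
Proof.
apply/ffunP => t; rewrite /extend sum_ffunE (bigD1 t) //= big1 ?addr0.
  by rewrite ffunMzE ffunE eqxx mulrzz mul1r.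
move=> u ut; rewrite ffunMzE ffunE !(inj_eq val_inj) eq_sym (negPf ut).
by rewrite mul0rz.
Qed.

Lemma extendD k l V (phi psi : seq G -> V) (c : MC G k l) :
  extend (fun s => phi s + psi s) c = extend phi c + extend psi c.
Proof.
by rewrite /extend -big_split; apply: eq_bigr => t _; rewrite mulrzDl.
Qed.

Lemma raddf_extend k l V W (f : {additive V -> W}) phi (c : MC G k l) :
  f (extend phi c) = extend (f \o phi) c.
Proof.
by rewrite /extend raddf_sum; apply: eq_bigr => t _; rewrite raddfMz.
Qed.

Lemma eq_extend k l V (phi psi : seq G -> V) (c : MC G k l) :
  (forall t : simplex G k l, phi (val (val t)) = psi (val (val t))) ->
  extend phi c = extend psi c.
Proof. by move=> h; apply: eq_bigr => t _; rewrite h. Qed.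

Lemma bdE k m l (c : MC G k l) : bd m c = extend (cbd (gen m l)) c.
Proof. by apply: eq_bigr => t _; rewrite /bd_gen cbd_sum. Qed.

Lemma extend_bd k m l V (phi : seq G -> V) (c : MC G k l) :
  k = m + 1 -> (0 < l)%N -> extend phi (bd m c) = extend (cbd phi) c.
Proof.
move=> km l0; rewrite bdE raddf_extend; apply: eq_extend => t.
have lt := chain_simplex t; have k0 : 0 <= k by case/and3P: (valP t).
have szt : size (val (val t)) = (`|k|%N).+1 by rewrite size_tuple.
move: lt szt; case: (val (val t)) => [//|x s] xs [szs].
rewrite /comp raddf_cbd; apply: cbd_local xs _ => u xu su /=.
apply: extend_gen => //; first by lia.
by rewrite /=; lia.
Qed.

Variables (i : nat) (gir : ele (Some (2 * i + 5)%N) (girth G)).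

Definition nonalternating k l (c : MC G k l) : MC G k l :=
  extend (fun s => gen k l s *+
    (if s is [:: x, y & _] then ~~ alternating (step x y) s else false)) c.

(** On a cycle, the homotopy applied to the boundary vanishes. Adding this zero term reduces the
    claim to [homotopy] at each generator. *)
Lemma homotopy_cycle k l (c : MC G k l) : (0 < l)%N -> (l <= `|k| + i)%N ->
  bd (k - 1) c = 0 ->
  bd k (extend (contract (gen (k + 1) l)) c) = nonalternating c.
Proof.
move=> l0 li c0.
have: extend (cbd (contract (gen k l))) c = 0.
  by rewrite -(@extend_bd k (k - 1)) ?c0 ?raddf0 //; lia.
move=> h; rewrite raddf_extend -[LHS]addr0 -[X in _ + X]h -extendD.
apply: eq_extend => t.
have lt := chain_simplex t; have k0 : 0 <= k by case/and3P: (valP t).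
have szt : size (val (val t)) = (`|k|%N).+1 by rewrite size_tuple.
have [x [y [s es]]] := chain_cons2 lt l0.
rewrite es in lt szt *.
rewrite -(homotopy gir _ lt); last by rewrite /= in szt; lia.
congr (_ + _); rewrite /comp /contract raddf_chom.
have [a [b [dxy xy ys en]]] := (chain_cons _ _ _ _).1 lt.
have /andP[xw xwy] := stepP dxy xy.
apply: chom_local xw lt _ => u xu su /=.
rewrite /= in szt su; rewrite bdE extend_gen //=; first by lia.
by rewrite su; lia.
Qed.

End Complex.

(** * First isomorphism theorem for homology *)

Lemma homology_iso (U V W B : zmodType) (f : {additive U -> V})
    (g : {additive V -> W}) (ev : {additive V -> B}) :
  (forall v, g v = 0 -> ev v = 0 <-> exists u, f u = v) ->
  (forall b, exists2 v, g v = 0 & ev v = b) ->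
  zmod_iso (homology f g) B.
Proof.
move=> ev_im ev_onto.
have ker0 (z : ker g) : g (val z) = 0 by apply/eqP/(valP z).
have evE (z : ker g) : in_im f z = (ev (val z) == 0).
  by apply/asboolP/eqP => /(ev_im _ (ker0 z)).
pose phi (q : homology f g) := ev (val (repr q)).
have phi_pi z : phi (\pi_(homology f g) z)%qT = ev (val z).
  apply/eqP; rewrite -subr_eq0 -raddfB -raddfB -evE.
  have := Quotient.idealrBE (in_im f (g := g))
    (repr (\pi_(homology f g) z)%qT) z.
  by rewrite reprK eqxx.
have phiB : zmod_morphism phi.
  move=> p q; rewrite -[p]reprK -[q]reprK.
  by rewrite -(raddfB (\pi_(homology f g))%qT) !phi_pi !raddfB.
pose h := GRing.isZmodMorphism.Build (homology f g) B phi phiB.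
pose Phi : {additive homology f g -> B} := HB.pack phi h.
exists Phi.
have phi_onto b : exists q, phi q = b.
  have [v gv evb] := ev_onto b.
  have kv : v \in in_ker g by rewrite inE gv.
  by exists (\pi_(homology f g) (Sub v kv : ker g))%qT; rewrite phi_pi SubK.
have [psi psiK] := choice phi_onto; exists psi => // q.
have phi_eq0 p : phi p = 0 -> p = 0.
  move=> /eqP; rewrite -evE => im_p; rewrite -[p]reprK -[RHS](raddf0 \pi%qT).
  apply/eqP; rewrite -(Quotient.idealrBE (in_im f (g := g))) subr0.
  exact: im_p.
by apply/eqP; rewrite -subr_eq0; apply/eqP/phi_eq0; rewrite phiB psiK subrr.
Qed.

(** * Alternating walks and oriented edges *)

Section Zigzag.
Variable G : graph.
Implicit Types (x y w : G) (s : seq G) (V : zmodType) (l n : nat).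

Fixpoint zigzag x w n : seq G :=
  x :: if n is n'.+1 then zigzag w x n' else [::].

Lemma zigzagP x w s :
  alternating w (x :: s) = (x :: s == zigzag x w (size s)).
Proof.
elim: s x w => [|z s IH] x w; first by rewrite /= eqxx.
rewrite [LHS]/= [zigzag _ _ _]/= eqseq_cons eqxx andTb.
case: eqVneq => [->|zw]; first by rewrite andTb -IH.
by case: (size s) => [|n] /=; rewrite eqseq_cons (negPf zw).
Qed.

Lemma size_zigzag x w n : size (zigzag x w n) = n.+1.
Proof. by elim: n x w => //= n IH x w; rewrite IH. Qed.

Lemma zigzag_inj x w x' w' n :
  (0 < n)%N -> zigzag x w n = zigzag x' w' n -> (x, w) = (x', w').
Proof. by case: n => [//|[|n]] _ /= -[-> ->]. Qed.

Lemma zigzag_cons x w n : exists s, zigzag x w n = x :: s.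
Proof. by case: n => [|n] /=; eexists. Qed.

Lemma chain_zigzag x w n : adj x w -> chain n (zigzag x w n).
Proof.
elim: n x w => [|n IH] x w xw; first by rewrite chain1.
have [s es] := zigzag_cons w x n; rewrite /= es.
apply/chain_cons; exists 1%N, n; rewrite dist_adj // -es IH 1?adj_sym //.
by split=> //; apply: contraTneq xw => ->; rewrite adj_irr.
Qed.

(** The two neighbours of each inner vertex coincide, so nothing can be deleted. *)
Lemma cbd_zigzag V (phi : seq G -> V) x w n :
  adj x w -> cbd phi (zigzag x w n) = 0.
Proof.
elim: n phi x w => [|[|n] IH] phi x w xw; first by rewrite cbd1.
  by rewrite cbd2.
have wx : adj w x by rewrite adj_sym.
have [s es] := zigzag_cons x w n.
have := IH (phi \o cons x) w x wx.
have [-> ->] : zigzag w x n.+1 = [:: w, x & s] /\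
    zigzag x w n.+2 = [:: x, w, x & s] by rewrite /= es.
rewrite cbd_cons => ->; rewrite (between_adj xw (dist_adj wx)) distxx.
by rewrite subr0.
Qed.

Definition darts : {set G * G} := [set p | adj p.1 p.2].

(** Sort the ordered pairs by underlying edge; each edge has two orientations. *)
Lemma card_darts : #|darts| = (2 * #|edges G|)%N.
Proof.
have -> : #|darts| = (\sum_(p in darts) 1)%N by rewrite sum1_card.
rewrite (partition_big (fun p => [set p.1; p.2]) (mem (edges G))) /=;
  last first.
  move=> [x y]; rewrite !inE /= => xy; apply/existsP; exists x.
  by apply/existsP; exists y; rewrite xy eqxx.
rewrite mulnC -sum_nat_const; apply: eq_bigr => A.
rewrite inE => /existsP[x /existsP[y /andP[xy /eqP->]]].
have xNy : x != y by apply: contraTneq xy => ->; rewrite adj_irr.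
have pq : ((x, y) != (y, x)) by rewrite xpair_eqE (negPf xNy).
rewrite sum1_card -[RHS](_ : #|[set (x, y); (y, x)]| = 2)%N;
  last by rewrite cards2 pq.
apply: eq_card => -[u v]; rewrite !inE /= unfold_in /= !inE /= !xpair_eqE.
apply/andP/orP => [[uv /eqP e] | [/andP[/eqP-> /eqP->] | /andP[/eqP-> /eqP->]]].
- have := set21 u v; have := set22 u v; rewrite e !inE.
  move=> /orP[/eqP ev|/eqP ev] /orP[/eqP eu|/eqP eu]; subst u v.
  + by rewrite adj_irr in uv.
  + by right; rewrite !eqxx.
  + by left; rewrite !eqxx.
  + by rewrite adj_irr in uv.
- by rewrite xy.
- by rewrite adj_sym xy setUC.
Qed.

Definition dart (j : 'I_(2 * #|edges G|)) : G * G :=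
  enum_val (cast_ord (esym card_darts) j).

Lemma dart_adj j : adj (dart j).1 (dart j).2.
Proof. by have := enum_valP (cast_ord (esym card_darts) j); rewrite inE. Qed.

Lemma dart_inj : injective dart.
Proof. by move=> j j' /enum_val_inj/cast_ord_inj. Qed.

Lemma dart_onto x y : adj x y -> exists j, dart j = (x, y).
Proof.
move=> xy; have xyd : (x, y) \in darts by rewrite inE.
exists (cast_ord card_darts (enum_rank_in xyd (x, y))).
by rewrite /dart cast_ordK enum_rankK_in.
Qed.

(** The coordinates at the alternating generators; on cycles of degree [l] they induce the
    isomorphism. *)
Definition zigzag_coef k l (c : MC G k l) : 'rV[int]_(2 * #|edges G|) :=
  \row_j extend (fun s => (s == zigzag (dart j).1 (dart j).2 l)%:R) c.

Lemma zigzag_coef_is_zmod_morphism k l : zmod_morphism (@zigzag_coef k l).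
Proof. by move=> c c'; apply/rowP => j; rewrite !mxE raddfB. Qed.

HB.instance Definition _ k l :=
  GRing.isZmodMorphism.Build (MC G k l) 'rV[int]_(2 * #|edges G|)
    (@zigzag_coef k l) (@zigzag_coef_is_zmod_morphism k l).

End Zigzag.

(** * Computation of the homology on and near the diagonal *)

Section Vanishing.
Variables (G : graph) (l i : nat) (l0 : (0 < l)%N).
Variable (gir : ele (Some (2 * i + 5)%N) (girth G)).
Implicit Type k : int.

Lemma simplex_step k (t : simplex G k l) : exists x y s,
  [/\ val (val t) = [:: x, y & s], adj x (step x y) & size s = `|k|.-1].
Proof.
have lt := chain_simplex t.
have szt : size (val (val t)) = `|k|.+1 := size_tuple _.
have [x [y [s es]]] := chain_cons2 lt l0.
rewrite es in lt szt *; exists x, y, s.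
split=> //; last by move: szt => /=; lia.
have [a [b [dxy xy _ _]]] := (chain_cons _ _ _ _).1 lt.
by case/andP: (stepP dxy xy).
Qed.

Lemma nonalternating_id k (c : MC G k l) : k < l%:Z -> nonalternating c = c.
Proof.
move=> kl; rewrite -[RHS]extend_genE; apply: eq_extend => t.
have lt := chain_simplex t.
have szt : size (val (val t)) = `|k|.+1 := size_tuple _.
have k0 : 0 <= k by case/and3P: (valP t).
have [x [y [s [es xw _]]]] := simplex_step t.
rewrite es in lt szt *; case: (boolP (alternating _ _)) => // alt.
by have := alternating_chain xw lt alt; move: szt => /=; lia.
Qed.

Lemma nonalternatingE k (c : MC G k l) (t : simplex G k l) :
  nonalternating c t = c t *+
    (if val (val t) is [:: x, y & _]
     then ~~ alternating (step x y) (val (val t)) else false).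
Proof.
rewrite /nonalternating /extend sum_ffunE (bigD1 t) //= big1 ?addr0.
  by rewrite ffunMzE ffunMnE ffunE eqxx mulrzz mulrnAl mul1r.
move=> u ut; rewrite ffunMzE ffunMnE ffunE !(inj_eq val_inj) eq_sym (negPf ut).
by rewrite mul0rn mul0rz.
Qed.

Lemma MC_eq0 k (c : MC G k l) : (l < `|k|)%N -> c = 0.
Proof.
move=> lk; apply/ffunP => t.
by have := chain_size (chain_simplex t); rewrite size_tuple /=; lia.
Qed.

Lemma MH_vanishing k : k < l%:Z -> l%:Z <= k + i%:Z ->
  zmod_iso (MH G k l) 'rV[int]_0.
Proof.
move=> kl li; pose ev : MC G k l -> 'rV[int]_0 := fun=> 0.
have evB : zmod_morphism ev by move=> c c'; rewrite subr0.
pose h := GRing.isZmodMorphism.Build _ _ ev evB.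
pose Ev : {additive MC G k l -> 'rV[int]_0} := HB.pack ev h.
apply: (homology_iso (ev := Ev)) => [c c0 | b].
  split=> // _; exists (extend (contract (gen (k + 1) l)) c).
  apply: etrans (nonalternating_id c kl).
  by apply: (homotopy_cycle gir) => //; lia.
by exists 0; rewrite raddf0 // [b]thinmx0.
Qed.

Lemma extend_zigzag (V : zmodType) (phi : seq G -> V) x w : adj x w ->
  extend phi (gen l%:Z l (zigzag x w l)) = phi (zigzag x w l).
Proof.
by move=> xw; rewrite extend_gen ?size_zigzag //; apply: chain_zigzag.
Qed.

(** The homotopy lands in degree [l + 1], where there are no generators. So the nonalternating part
    of a cycle is 0, and the coefficients determine the rest. *)
Lemma zigzag_coef_eq0 (c : MC G l%:Z l) :
  bd (l%:Z - 1) c = 0 -> zigzag_coef c = 0 -> c = 0.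
Proof.
move=> c0 coef0; have: nonalternating c = 0.
  rewrite -(homotopy_cycle gir) //=; last by lia.
  have -> : extend (contract (gen (l%:Z + 1) l)) c = 0 by apply: MC_eq0; lia.
  by rewrite raddf0.
move=> na0; apply/ffunP => t; rewrite [RHS]ffunE.
have := nonalternatingE c t; rewrite na0 ffunE => /esym.
have [x [y [s [es xw szs]]]] := simplex_step t; rewrite es.
case: (boolP (alternating _ _)) => // alt _.
have et : val (val t) = zigzag x (step x y) l.
  have sl : (size s).+1 = l by lia.
  by move: alt; rewrite zigzagP -es [size _]/= sl => /eqP.
have [j ej] := dart_onto xw.
have := congr1 (fun r : 'rV[int]__ => r 0 j) coef0.
rewrite !mxE ej -et /extend (bigD1 t) // big1 ?addr0 => [|u /andP[_ ut]].
  by rewrite eqxx mulrzz mul1r => <-; rewrite [RHS]addr0.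
by rewrite !(inj_eq val_inj) (negPf ut) mul0rz.
Qed.

Lemma bd_zigzag x w : adj x w ->
  bd (l%:Z - 1) (gen l%:Z l (zigzag x w l)) = 0 :> MC G (l%:Z - 1) l.
Proof. by move=> xw; rewrite bdE extend_zigzag // cbd_zigzag. Qed.

Lemma zigzag_coef_dart (j : 'I_(2 * #|edges G|)) :
  zigzag_coef (gen l%:Z l (zigzag (dart j).1 (dart j).2 l)) = delta_mx 0 j.
Proof.
apply/rowP => j'; rewrite !mxE extend_zigzag ?dart_adj // eqxx [in RHS]eq_sym.
congr (nat_of_bool _)%:R; apply/eqP/eqP => [/(zigzag_inj l0)|-> //].
by rewrite -!surjective_pairing => /dart_inj.
Qed.

Lemma MH_diagonal : zmod_iso (MH G l%:Z l) 'rV[int]_(2 * #|edges G|).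
Proof.
apply: (homology_iso (ev := @zigzag_coef G l%:Z l)) => [c c0 | b].
  split=> [/(zigzag_coef_eq0 c0) -> | [u <-]].
    by exists 0; rewrite raddf0.
  have -> : u = 0 by apply: MC_eq0; lia.
  by rewrite !raddf0.
(* The alternating walks are cycles, so any coefficients can be prescribed. *)
exists (\sum_j gen l%:Z l (zigzag (dart j).1 (dart j).2 l) *~ b 0 j).
  rewrite raddf_sum big1 // => j _; rewrite raddfMz.
  by rewrite -[RHS](mul0rz _ (b 0 j)) -(bd_zigzag (dart_adj j)).
rewrite raddf_sum [RHS]row_sum_delta; apply: eq_bigr => j _.
by rewrite raddfMz -scaler_int intz; congr (_ *: _); apply: zigzag_coef_dart.
Qed.

End Vanishing.

Theorem corollary1p4 (G : graph) (l i : nat) (hl : (1 <= l)%N)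
    (hgirth : ele (Some (2 * i + 5)%N) (girth G)) :
  zmod_iso (MH G l%:Z l) 'rV[int]_(2 * #|edges G|) /\
  (forall j : nat, (1 <= j <= i)%N ->
     zmod_iso (MH G (l%:Z - j%:Z) l) 'rV[int]_0).
Proof.
split; first exact: MH_diagonal hgirth.
move=> j ji; by apply: (MH_vanishing hl hgirth); lia.
Qed.
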